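(* If a proper metric space $X$ admits a (possibly non-reversible) bicombing $\sigma$, then $X$ admits a reversible bicombing $\tilde\sigma$.
   Context: A bicombing on a metric space $(X,d)$ is a map $\sigma\colon X\times X\times[0,1]\to X$, written $\sigma_{xy}(t):=\sigma(x,y,t)$, such that for all $x,y\in X$ one has $\sigma_{xy}(0)=x$, $\sigma_{xy}(1)=y$ and $d(\sigma_{xy}(t),\sigma_{xy}(t'))=|t-t'|\,d(x,y)$ for all $t,t'\in[0,1]$, and such that the conical property holds: $d(\sigma_{xy}(t),\sigma_{x'y'}(t))\le(1-t)\,d(x,x')+t\,d(y,y')$ for all $t\in[0,1]$ and all $x,y,x',y'\in X$. The bicombing $\sigma$ is reversible if $\sigma_{xy}(t)=\sigma_{yx}(1-t)$ for all $x,y\in X$ and $t\in[0,1]$. A metric space is proper if all closed balls are compact. *)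

(* Defs.v *)
From HB Require Import structures.
From mathcomp Require Import all_boot all_order all_algebra.
From mathcomp Require Import all_classical all_reals all_analysis.

Set Implicit Arguments.
Unset Strict Implicit.
Unset Printing Implicit Defensive.

Import Order.TTheory GRing.Theory Num.Theory.
Import numFieldNormedType.Exports.

Local Open Scope classical_set_scope.
Local Open Scope ring_scope.

(* The library's [closed_ball] is the closure of the open ball, which in a
   general metric space can be smaller than {y | d(x, y) <= r}. *)
Definition proper_metric (R : realType) (X : metricType R) : Prop :=
  forall (x : X) (r : R), compact [set y : X | mdist x y <= r].

(* [s x y t] is sigma_xy(t).  The map is total in t, but only its values on
   [0, 1] are constrained; those outside carry no meaning. *)
Record is_bicombing (R : realType) (X : metricType R)
    (s : X -> X -> R -> X) : Prop := IsBicombing {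
  bicombing0 : forall x y : X, s x y 0 = x ;
  bicombing1 : forall x y : X, s x y 1 = y ;
  bicombing_geodesic : forall (x y : X) (t t' : R),
    0 <= t <= 1 -> 0 <= t' <= 1 ->
    mdist (s x y t) (s x y t') = `|t - t'| * mdist x y ;
  bicombing_conical : forall (x y x' y' : X) (t : R), 0 <= t <= 1 ->
    mdist (s x y t) (s x' y' t) <= (1 - t) * mdist x x' + t * mdist y y'
}.

Definition reversible (R : realType) (X : metricType R)
    (s : X -> X -> R -> X) : Prop :=
  forall (x y : X) (t : R), 0 <= t <= 1 -> s x y t = s y x (1 - t).

(* Main.v *)
Require Import Defs.
From HB Require Import structures.
From mathcomp Require Import all_boot all_order all_algebra.
From mathcomp Require Import all_classical all_reals all_analysis.
From mathcomp Require Import lra.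

Import Order.TTheory GRing.Theory Num.Theory.

Local Open Scope classical_set_scope.
Local Open Scope ring_scope.

(** With [m x y := sigma_xy(1/2)], start from the pair
    [(sigma_xy(t), sigma_yx(1 - t))] and iterate [(p, q) |-> (m p q, m q p)].
    In the product [X * X] this is the Krasnoselskii iteration of the isometry
    [(p, q) |-> (q, p)], so the Goebel-Kirk-Ishikawa inequality shows that the
    distance between the two components tends to [0].  For every [c] the
    quantity [d(p, c) + d(q, c)] is nonincreasing along the iteration, so that,
    [X] being proper, both components converge to a common cluster point.  The
    limit depends symmetrically on the starting pair, and in a 1-Lipschitz way
    for the sup distance on pairs; hence it defines a reversible bicombing. *)

Section AveragingIteration.
Context {R : realType} {X : metricType R} (m : X -> X -> X).

Definition averaging_step (z : X * X) : X * X := (m z.1 z.2, m z.2 z.1).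

Definition averaging_orbit (p q : X) (n : nat) : X * X :=
  iter n averaging_step (p, q).

Lemma averaging_orbitS (p q : X) (n : nat) :
  averaging_orbit p q n.+1 = averaging_step (averaging_orbit p q n).
Proof. exact: iterS. Qed.

Lemma averaging_orbit_swap (p q : X) (n : nat) :
  averaging_orbit q p n =
    ((averaging_orbit p q n).2, (averaging_orbit p q n).1).
Proof. by elim: n => [//|n IH]; rewrite !averaging_orbitS IH. Qed.

Hypothesis m_conical : forall x y x' y' : X,
  mdist (m x y) (m x' y') <= (mdist x x' + mdist y y') / 2.

Lemma averaging_orbit_le (p q p' q' : X) (e : R) (n : nat) :
  mdist p p' <= e -> mdist q q' <= e ->
  mdist (averaging_orbit p q n).1 (averaging_orbit p' q' n).1 <= e /\
  mdist (averaging_orbit p q n).2 (averaging_orbit p' q' n).2 <= e.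
Proof.
move=> hp hq; elim: n => [//|n [IH1 IH2]].
rewrite !averaging_orbitS /=.
set z := averaging_orbit p q n in IH1 IH2 *.
set z' := averaging_orbit p' q' n in IH1 IH2 *.
have h1 := m_conical z.1 z.2 z'.1 z'.2.
have h2 := m_conical z.2 z.1 z'.2 z'.1.
by split; lra.
Qed.

Hypothesis mxx : forall x : X, m x x = x.

Section Orbit.
Variables p q : X.
Local Notation P n := (averaging_orbit p q n).1.
Local Notation Q n := (averaging_orbit p q n).2.

(** Since [m c c = c], conicality bounds the distance from [c] to each new component by the mean of
    the two old distances; add the two bounds. *)
Lemma averaging_orbit_fejerS (c : X) (n : nat) :
  mdist (P n.+1) c + mdist (Q n.+1) c <= mdist (P n) c + mdist (Q n) c.
Proof.
rewrite averaging_orbitS /=.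
have := m_conical (P n) (Q n) c c; have := m_conical (Q n) (P n) c c.
rewrite mxx; lra.
Qed.

Lemma averaging_orbit_fejer (c : X) (n k : nat) : (n <= k)%N ->
  mdist (P k) c + mdist (Q k) c <= mdist (P n) c + mdist (Q n) c.
Proof.
elim: k => [|k IH]; first by rewrite leqn0 => /eqP ->.
rewrite leq_eqVlt => /predU1P[->//|/IH h].
exact: le_trans (averaging_orbit_fejerS c k) h.
Qed.

Lemma averaging_orbit_gapS (n : nat) :
  mdist (P n.+1) (Q n.+1) <= mdist (P n) (Q n).
Proof.
rewrite averaging_orbitS /=.
have := m_conical (P n) (Q n) (Q n) (P n).
rewrite (metric_sym (Q n) (P n)); lra.
Qed.

Lemma averaging_orbit_gap_le (n k : nat) : (n <= k)%N ->
  mdist (P k) (Q k) <= mdist (P n) (Q n).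
Proof.
elim: k => [|k IH]; first by rewrite leqn0 => /eqP ->.
rewrite leq_eqVlt => /predU1P[->//|/IH h].
exact: le_trans (averaging_orbit_gapS k) h.
Qed.

(** Fejer monotonicity with [c = p] keeps both components within [mdist p q] of [p]. *)
Lemma averaging_orbit_bounded (i j : nat) :
  mdist (P i) (Q j) <= mdist p q *+ 2.
Proof.
have := averaging_orbit_fejer p 0%N i (leq0n i).
have := averaging_orbit_fejer p 0%N j (leq0n j).
have := metric_triangle (P i) p (Q j).
rewrite /= !mdistxx (metric_sym p (Q j)) (metric_sym q p).
have := mdist_ge0 (Q i) p; have := mdist_ge0 (P j) p; lra.
Qed.

(** Comparing [m Q P] with [m Q Q = Q], each step moves [Q] by at most half the current gap, and
    gaps never increase. *)
Lemma averaging_orbit_drift (i k : nat) :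
  mdist (Q i) (Q (i + k)) <= k%:R / 2 * mdist (P i) (Q i).
Proof.
elim: k => [|k IH]; first by rewrite addn0 mdistxx !mul0r.
have tri := metric_triangle (Q i) (Q (i + k)) (Q (i + k.+1)).
have gap := averaging_orbit_gap_le _ _ (leq_addr k i).
have := m_conical (Q (i + k)) (Q (i + k)) (Q (i + k)) (P (i + k)).
rewrite mxx mdistxx (metric_sym _ (P _)).
rewrite addnS averaging_orbitS /= in tri *.
rewrite -(natr1 k); lra.
Qed.

(* Goebel-Kirk-Ishikawa: if the gaps from index [i] on are within [e] of [L],
   the distance from [P i] to [Q (i + n)] grows linearly in [n], up to an error
   that vanishes with [e] for fixed [n]. *)
Lemma averaging_orbit_growth (n : nat) :
  exists C : R, forall (i : nat) (L e : R),
  (forall k, (i <= k)%N -> L <= mdist (P k) (Q k) <= L + e) ->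
  (1 + n%:R / 2) * L <= mdist (P i) (Q (i + n)) + C * e.
Proof.
elim: n => [|n [C IH]].
  exists 0 => i L e /(_ i (leqnn i)) /andP[+ _].
  by rewrite addn0; lra.
(* The hypothesis at [i.+1] is doubled, as [P i.+1] is a midpoint of [P i] and [Q i]: this gives
   [2 * C]. Bounding the drift of [Q] by [n.+1%:R / 2 * (L + e)] gives the other term, and
   [2 + n - (n + 1) / 2 = 1 + (n + 1) / 2]. *)
exists (2 * C + n.+1%:R / 2) => i L e he.
have /IH : forall k, (i.+1 <= k)%N -> L <= mdist (P k) (Q k) <= L + e.
  by move=> k /ltnW /he.
rewrite addSnnS.
have := averaging_orbit_drift i n.+1.
have /andP[_ gap] := he i (leqnn i).
have := m_conical (P i) (Q i) (Q (i + n.+1)) (Q (i + n.+1)).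
rewrite mxx (averaging_orbitS p q i) /=.
have : n.+1%:R / 2 * mdist (P i) (Q i) <= n.+1%:R / 2 * (L + e).
  by rewrite ler_wpM2l// divr_ge0.
rewrite -(natr1 n); lra.
Qed.

(** A positive infimum [L] of the gaps would make the distances between [P] and [Q] grow linearly,
    against their uniform bound. *)
Lemma averaging_orbit_gap_cvg0 (e : R) : 0 < e ->
  exists N, forall n, (N <= n)%N -> mdist (P n) (Q n) < e.
Proof.
move=> e0; set D := range (fun n => mdist (P n) (Q n)); set L := inf D.
have D_lb : has_lbound D by exists 0 => _ [n _ <-]; exact: mdist_ge0.
have D_inf : has_inf D by split=> //; exists (mdist (P 0) (Q 0)); exists 0%N.
have L_le n : L <= mdist (P n) (Q n) by apply: ge_inf => //; exists n.
have near_L d : 0 < d ->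
    exists N, forall n, (N <= n)%N -> mdist (P n) (Q n) < L + d.
  move=> d0; have [_ [N _ <-] hN] := inf_adherent d0 D_inf.
  by exists N => n /averaging_orbit_gap_le /le_lt_trans; apply.
suff L0 : L <= 0.
  have [N hN] := near_L e e0; exists N => n /hN; lra.
rewrite leNgt; apply/negP => L0.
have linear n : (1 + n%:R / 2) * L <= mdist p q *+ 2.
  have [C hC] := averaging_orbit_growth n.
  apply/ler_addgt0Pr => d d0.
  (* [C] depends on [n] only, so the starting index can be chosen after it to make the error at most
     [d]. *)
  have C0 : 0 < `|C| + 1 by rewrite ltr_wpDl.
  have [N hN] := near_L (d / (`|C| + 1)) (divr_gt0 d0 C0).
  apply: (le_trans (hC N L (d / (`|C| + 1)) _)).
    by move=> k /hN /ltW ->; rewrite L_le.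
  apply: lerD; first exact: averaging_orbit_bounded.
  rewrite mulrA ler_pdivrMr// mulrC ler_pM2l//.
  by rewrite (le_trans (ler_norm C))// lerDl.
(* [linear] fails for any [n] above this value. *)
have b0 : 0 <= 4 * mdist p q / L.
  by rewrite divr_ge0 ?mulr_ge0 ?mdist_ge0 ?ltW.
have := archi_boundP b0; rewrite ltr_pdivrMr//.
have := linear (Num.bound (4 * mdist p q / L)); lra.
Qed.

Lemma averaging_orbit_cvg : proper_metric X ->
  exists c : X, forall e, 0 < e ->
    exists N, forall n, (N <= n)%N -> mdist (P n) c < e /\ mdist (Q n) c < e.
Proof.
move=> hX.
have inB n : mdist p (P n) <= mdist p q.
  have := averaging_orbit_fejer p 0%N n (leq0n n).
  rewrite /= mdistxx (metric_sym q p) (metric_sym p (P n)).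
  have := mdist_ge0 (Q n) p; lra.
have [c [_ c_cluster]] : [set y | mdist p y <= mdist p q] `&`
    cluster ((fun n => P n) @ \oo) !=set0.
  by apply: hX; exists 0%N => // n _; exact: inB.
exists c => e e0; have e3 : 0 < e / 3 by rewrite divr_gt0.
have [N hN] := averaging_orbit_gap_cvg0 (e / 3) e3.
have [_ [[n Nn <-] cn]] : ((fun n => P n) @` [set n | (N <= n)%N]) `&`
    ball c (e / 3) !=set0.
  apply: c_cluster; last exact: nbhsx_ballx.
  by exists N => // n /= Nn; exists n.
(* At time [n] the distances to [c] are below [e / 3] and [2 * e / 3]; their sum stays below [e] by
   Fejer monotonicity. *)
exists n => k nk.
move: cn; rewrite ballEmdist /= metric_sym => cn.
have := averaging_orbit_fejer c n k nk; have := hN n Nn.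
have := metric_triangle (Q n) (P n) c; rewrite (metric_sym (Q n) (P n)).
have := mdist_ge0 (P k) c; have := mdist_ge0 (Q k) c.
by split; lra.
Qed.

End Orbit.

Lemma symmetric_mean_exists : proper_metric X ->
  exists M : X -> X -> X,
    [/\ forall x, M x x = x,
        forall x y, M x y = M y x &
        forall x y x' y' e, mdist x x' <= e -> mdist y y' <= e ->
          mdist (M x y) (M x' y') <= e].
Proof.
move=> hX.
have /choice [M hM] (z : X * X) := averaging_orbit_cvg z.1 z.2 hX.
have M_lip x y x' y' e : mdist x x' <= e -> mdist y y' <= e ->
    mdist (M (x, y)) (M (x', y')) <= e.
  move=> hx hy; apply/ler_addgt0Pr => d d0.
  have d2 : 0 < d / 2 by rewrite divr_gt0.
  have [N1 h1] := hM (x, y) _ d2; have [N2 h2] := hM (x', y') _ d2.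
  have [/= + _] := h1 _ (leq_maxl N1 N2).
  have [/= + _] := h2 _ (leq_maxr N1 N2).
  have [+ _] := averaging_orbit_le _ _ _ _ _ (maxn N1 N2) hx hy.
  set a := (averaging_orbit x y _).1; set b := (averaging_orbit x' y' _).1.
  have := metric_triangle (M (x, y)) a (M (x', y')).
  have := metric_triangle a b (M (x', y')).
  rewrite (metric_sym (M (x, y)) a); lra.
exists (fun x y => M (x, y)); split=> // [x|x y].
  have fixed n : averaging_orbit x x n = (x, x).
    elim: n => [//|n IH].
    by rewrite averaging_orbitS IH /averaging_step /= mxx.
  apply/esym/mdist_positivity/eqP; rewrite eq_le mdist_ge0 andbT.
  apply/ler_addgt0Pr => d d0; rewrite add0r.
  by have [N /(_ N (leqnn N))] := hM (x, x) d d0; rewrite fixed /= => -[/ltW].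
apply/mdist_positivity/eqP; rewrite eq_le mdist_ge0 andbT.
apply/ler_addgt0Pr => d d0; rewrite add0r.
have d2 : 0 < d / 2 by rewrite divr_gt0.
have [N1 h1] := hM (x, y) _ d2; have [N2 h2] := hM (y, x) _ d2.
have [/= + _] := h1 _ (leq_maxl N1 N2); have [/= _ +] := h2 _ (leq_maxr N1 N2).
rewrite (averaging_orbit_swap x y) /=; set a := (averaging_orbit x y _).1.
have := metric_triangle (M (x, y)) a (M (y, x)).
rewrite (metric_sym (M (x, y)) a); lra.
Qed.

End AveragingIteration.

(** For [s <= t] the upper bounds on the three pieces of the path from [x] to [y] add up to
    [mdist x y], so the triangle inequality makes each an equality. *)
Lemma geodesic_of_lipschitz (R : realType) (X : metricType R) (x y : X)
    (c : R -> X) : c 0 = x -> c 1 = y ->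
  (forall s t, 0 <= s <= 1 -> 0 <= t <= 1 ->
    mdist (c s) (c t) <= `|s - t| * mdist x y) ->
  forall s t, 0 <= s <= 1 -> 0 <= t <= 1 ->
    mdist (c s) (c t) = `|s - t| * mdist x y.
Proof.
move=> c0 c1 c_lip s t.
wlog st : s t / s <= t.
  move=> H hs ht; have [/H|/ltW /H] := leP s t; first exact.
  by rewrite metric_sym distrC; apply.
move=> hs ht; apply/eqP; rewrite eq_le c_lip//=.
have h0 : 0 <= (0 : R) <= 1 by rewrite lexx ler01.
have h1 : 0 <= (1 : R) <= 1 by rewrite lexx ler01.
move: (c_lip _ _ h0 hs) (c_lip _ _ ht h1).
have := metric_triangle x (c s) y; have := metric_triangle (c s) (c t) y.
have /andP[s0 s1] := hs; have /andP[t0 t1] := ht.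
rewrite c0 c1 sub0r normrN (ger0_norm s0).
rewrite (distrC t) (distrC s) !ger0_norm ?subr_ge0//; lra.
Qed.

Theorem proposition1p2 (R : realType) (X : metricType R)
    (sigma : X -> X -> R -> X)
    (hproper : proper_metric X) (hsigma : is_bicombing sigma) :
  exists sigma' : X -> X -> R -> X, is_bicombing sigma' /\ reversible sigma'.
Proof.
have [sigma0 sigma1 geo con] := hsigma.
have half : 0 <= (2^-1 : R) <= 1 by lra.
have [||M [Mxx MC M_lip]] :=
  @symmetric_mean_exists R X (fun x y => sigma x y 2^-1) _ _ hproper.
- by move=> x y x' y'; have := con x y x' y' _ half; lra.
- move=> x; apply: mdist_positivity.
  rewrite -[X in mdist _ X](sigma0 x x) geo ?lexx ?ler01//.
  by rewrite mdistxx mulr0.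
(* Reversing the path swaps the arguments of [M]. Both arguments obey the same geodesic and conical
   bounds, so the sup-Lipschitz property of [M] transfers them. *)
exists (fun x y t => M (sigma x y t) (sigma y x (1 - t))); split; last first.
  by move=> x y t _; rewrite MC subKr.
have rev01 (t : R) : 0 <= t <= 1 -> 0 <= 1 - t <= 1 by lra.
have end0 x y : M (sigma x y 0) (sigma y x (1 - 0)) = x.
  by rewrite subr0 sigma0 sigma1 Mxx.
have end1 x y : M (sigma x y 1) (sigma y x (1 - 1)) = y.
  by rewrite subrr sigma0 sigma1 Mxx.
split=> // [x y|x y x' y' t ht].
- apply: (@geodesic_of_lipschitz R X x y
    (fun t => M (sigma x y t) (sigma y x (1 - t)))) => // s t hs ht.
  apply: M_lip; first by rewrite geo.
  rewrite geo ?rev01// (metric_sym y x).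
  by rewrite distrC (_ : 1 - t - (1 - s) = s - t)//; lra.
- apply: M_lip; first exact: con.
  by have := con y x y' x' _ (rev01 t ht); lra.
Qed.
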